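(* Let $H$ be a Hilbert module over a $C^*$-algebra. For every idempotent $Q\in\mathcal{L}(H)$, we have $m(Q^* )=m(Q)$, where $m(\cdot)$ denotes the matched projection.
   Context: $\mathcal{L}(H)$ is the $C^*$-algebra of adjointable operators on the Hilbert $C^*$-module $H$, and $I$ is the identity operator on $H$. $\mathcal{R}(\cdot)$ and $\mathcal{N}(\cdot)$ denote range and null space. An idempotent is $Q\in\mathcal{L}(H)$ with $Q^2=Q$; a projection is a self-adjoint idempotent. $P_{\mathcal{R}(Q)}$ is the projection of $H$ onto the (orthogonally complemented) range of $Q$. Definition of the matched projection $m(Q)$ of an idempotent $Q\in\mathcal{L}(H)$: if $Q$ is a projection, $m(Q)=Q$. Otherwise, $H=\mathcal{R}(Q)\dotplus\mathcal{N}(Q^* )$ is an orthogonal decomposition; let $U:H\to\mathcal{R}(Q)\oplus\mathcal{N}(Q^* )$ be the unitary $Uh=\binom{P_{\mathcal{R}(Q)}h}{(I-P_{\mathcal{R}(Q)})h}$, let $I_1$ be the identity on $\mathcal{R}(Q)$, let $A=(Q-P_{\mathcal{R}(Q)})|_{\mathcal{N}(Q^* )}:\mathcal{N}(Q^* )\to\mathcal{R}(Q)$ and $B=(AA^*+I_1)^{1/2}$, and set $$m(Q)=U^*\cdot\frac12\begin{pmatrix}(B+I_1)B^{-1} & B^{-1}A\\ A^*B^{-1} & A^*[B(B+I_1)]^{-1}A\end{pmatrix}\cdot U .$$ *)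

(* Defs.v *)
From HB Require Import structures.
From mathcomp Require Import all_boot all_order all_algebra.
From mathcomp Require Import complex.
From mathcomp Require Import all_classical all_reals all_analysis.

Set Implicit Arguments.
Unset Strict Implicit.
Unset Printing Implicit Defensive.

Import Order.TTheory GRing.Theory Num.Theory.
Import numFieldNormedType.Exports.

Local Open Scope classical_set_scope.
Local Open Scope ring_scope.
Local Open Scope complex_scope.

(* C*-algebras need not have a unit, so the product cannot be inherited from
   the MathComp ring structures, which are all unital. *)
HB.mixin Record NormedModule_isCStar (R : realType) A
    of CompleteNormedModule R[i] A := {
  cmul : A -> A -> A;
  cstar : A -> A;
  cmulA : associative cmul;
  cmulDl : left_distributive cmul +%R;
  cmulDr : right_distributive cmul +%R;
  cmulZl : forall (k : R[i]) (a b : A), cmul (k *: a) b = k *: cmul a b;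
  cmulZr : forall (k : R[i]) (a b : A), cmul a (k *: b) = k *: cmul a b;
  cstarD : {morph cstar : a b / a + b};
  cstarZ : forall (k : R[i]) (a : A), cstar (k *: a) = Num.conj k *: cstar a;
  cstarM : forall a b : A, cstar (cmul a b) = cmul (cstar b) (cstar a);
  cstarK : involutive cstar;
  cnormM : forall a b : A, `|cmul a b| <= `|a| * `|b|;
  cnorm_star : forall a : A, `|cmul (cstar a) a| = `|a| ^+ 2 }.

#[short(type="cstarType")]
HB.structure Definition CStar (R : realType) :=
  {A of CompleteNormedModule R[i] A & NormedModule_isCStar R A}.

(* The elements b^* b are exactly the positive ones. *)
Definition cpositive (R : realType) (A : cstarType R) (a : A) : Prop :=
  exists b : A, a = cmul (cstar b) b.

(* A right A-module with an A-valued hermitian form, linear in its second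
   argument.  Positivity is only required in hilbertModType below: submodules
   and direct sums inherit the form, and this is all that is needed to speak
   of adjoints. *)
HB.mixin Record Lmodule_isForm (R : realType) (A : cstarType R) E
    of GRing.Lmodule R[i] E := {
  act : E -> A -> E;
  form : E -> E -> A;
  actDl : forall (x y : E) (a : A), act (x + y) a = act x a + act y a;
  actDr : forall (x : E) (a b : A), act x (a + b) = act x a + act x b;
  actM : forall (x : E) (a b : A), act x (cmul a b) = act (act x a) b;
  actZl : forall (k : R[i]) (x : E) (a : A), act (k *: x) a = k *: act x a;
  actZr : forall (k : R[i]) (x : E) (a : A), act x (k *: a) = k *: act x a;
  formDr : forall x y z : E, form x (y + z) = form x y + form x z;
  formZr : forall (k : R[i]) (x y : E), form x (k *: y) = k *: form x y;
  form_act : forall (x y : E) (a : A), form x (act y a) = cmul (form x y) a;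
  form_star : forall x y : E, cstar (form x y) = form y x }.

#[short(type="formModType")]
HB.structure Definition FormModule (R : realType) (A : cstarType R) :=
  {E of GRing.Lmodule R[i] E & Lmodule_isForm R A E}.

Notation "<| x , y |>" := (form x y) (at level 0, x, y at level 99).

(* The norm axiom determines the norm of H from the inner product, and yields
   definiteness since <|x, x|> = 0 forces `|x| = 0. *)
HB.mixin Record FormModule_isHilbert (R : realType) (A : cstarType R) H
    of CompleteNormedModule R[i] H & FormModule R A H := {
  form_ge0 : forall x : H, cpositive (<|x, x|> : A);
  form_norm : forall x : H, `|x| ^+ 2 = `|(<|x, x|> : A)| }.

#[short(type="hilbertModType")]
HB.structure Definition HilbertModule (R : realType) (A : cstarType R) :=
  {H of CompleteNormedModule R[i] H & FormModule R A H
      & FormModule_isHilbert R A H}.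

Section FormTheory.
Context (R : realType) (A : cstarType R) (E : formModType A).
Implicit Types x y z : E.

Lemma cstar0 : cstar (0 : A) = 0.
Proof. by apply: (@addrI A (cstar 0)); rewrite -cstarD !addr0. Qed.

Lemma formDl x y z : <|x + y, z|> = <|x, z|> + <|y, z|>.
Proof. by rewrite -form_star formDr cstarD !form_star. Qed.

Lemma formZl (k : R[i]) x y : <|k *: x, y|> = Num.conj k *: <|x, y|>.
Proof. by rewrite -form_star formZr cstarZ form_star. Qed.

Lemma formx0 x : <|x, 0|> = 0.
Proof. by rewrite -(scale0r (0 : E)) formZr scale0r. Qed.

Lemma form0x x : <|0, x|> = 0.
Proof. by rewrite -form_star formx0 cstar0. Qed.

Lemma formNr x y : <|x, - y|> = - <|x, y|>.
Proof. by rewrite -scaleN1r formZr scaleN1r. Qed.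

Lemma formNl x y : <|- x, y|> = - <|x, y|>.
Proof.
by apply: (addrI <|x, y|>); rewrite -formDl !subrr form0x.
Qed.

Lemma act0l (a : A) : act (0 : E) a = 0.
Proof. by apply: (addrI (act 0 a)); rewrite -actDl !addr0. Qed.

End FormTheory.

(* An adjointable map packed with an adjoint.  On Hilbert modules the adjoint
   is unique, and linearity and boundedness are automatic. *)
Record adjointable (R : realType) (A : cstarType R) (E F : formModType A) :=
  Adjointable {
    afun :> E -> F;
    aadj : F -> E;
    aadjP : forall x y, <|afun x, y|> = <|x, aadj y|> }.

Notation "''L' ( E , F )" := (adjointable E F) (at level 8).
Notation "''L' ( E )" := (adjointable E E) (at level 8).

Section Adjointable.
Context (R : realType) (A : cstarType R).
Implicit Types E F G : formModType A.

Lemma aadjP' E F (T : 'L(E, F)) x y : <|aadj T y, x|> = <|y, T x|>.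
Proof. by rewrite -form_star -aadjP form_star. Qed.

Definition adj E F (T : 'L(E, F)) : 'L(F, E) :=
  @Adjointable R A F E (aadj T) T (fun x y => aadjP' T y x).

Lemma adjointable_eq E F (S T : 'L(E, F)) :
  S =1 T -> aadj S =1 aadj T -> S = T.
Proof.
case: S T => [s s' sP] [t t' tP] /= /funext st /funext st'; subst t t'.
by congr Adjointable; apply: Prop_irrelevance.
Qed.

Definition aid E : 'L(E) := @Adjointable R A E E id id (fun _ _ => erefl).

Lemma acomp_subproof E F G (S : 'L(F, G)) (T : 'L(E, F)) x y :
  <|S (T x), y|> = <|x, aadj T (aadj S y)|>.
Proof. by rewrite !aadjP. Qed.

Definition acomp E F G (S : 'L(F, G)) (T : 'L(E, F)) : 'L(E, G) :=
  Adjointable (acomp_subproof S T).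

HB.instance Definition _ E F := gen_eqMixin 'L(E, F).
HB.instance Definition _ E F := gen_choiceMixin 'L(E, F).

Section Lmodule.
Context (E F : formModType A).
Implicit Types S T : 'L(E, F).

Lemma azero_subproof (x : E) (y : F) : <|(0 : F), y|> = <|x, (0 : E)|>.
Proof. by rewrite form0x formx0. Qed.

Definition azero : 'L(E, F) := Adjointable azero_subproof.

Lemma aopp_subproof T x y : <|- T x, y|> = <|x, - aadj T y|>.
Proof. by rewrite formNl formNr aadjP. Qed.

Definition aopp T : 'L(E, F) := Adjointable (aopp_subproof T).

Lemma aadd_subproof S T x y : <|S x + T x, y|> = <|x, aadj S y + aadj T y|>.
Proof. by rewrite formDl formDr !aadjP. Qed.

Definition aadd S T : 'L(E, F) := Adjointable (aadd_subproof S T).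

Lemma ascale_subproof (k : R[i]) T x y :
  <|k *: T x, y|> = <|x, Num.conj k *: aadj T y|>.
Proof. by rewrite formZl formZr aadjP. Qed.

Definition ascale k T : 'L(E, F) := Adjointable (ascale_subproof k T).

Fact aaddA : associative aadd.
Proof. by move=> S T U; apply: adjointable_eq => x /=; rewrite addrA. Qed.

Fact aaddC : commutative aadd.
Proof. by move=> S T; apply: adjointable_eq => x /=; rewrite addrC. Qed.

Fact aadd0 : left_id azero aadd.
Proof. by move=> S; apply: adjointable_eq => x /=; rewrite add0r. Qed.

Fact aaddN : left_inverse azero aopp aadd.
Proof. by move=> S; apply: adjointable_eq => x /=; rewrite addNr. Qed.

HB.instance Definition _ :=
  GRing.isZmodule.Build 'L(E, F) aaddA aaddC aadd0 aaddN.

Fact ascaleA a b T : ascale a (ascale b T) = ascale (a * b) T.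
Proof. by apply: adjointable_eq => x /=; rewrite scalerA // rmorphM. Qed.

Fact ascale1 : left_id 1 ascale.
Proof. by move=> T; apply: adjointable_eq => x /=; rewrite ?rmorph1 scale1r. Qed.

Fact ascaleDr : right_distributive ascale +%R.
Proof. by move=> k S T; apply: adjointable_eq => x /=; rewrite scalerDr. Qed.

Fact ascaleDl T : {morph ascale^~ T : a b / a + b}.
Proof.
by move=> a b; apply: adjointable_eq => x /=; rewrite ?rmorphD scalerDl.
Qed.

HB.instance Definition _ :=
  GRing.Zmodule_isLmodule.Build R[i] 'L(E, F) ascaleA ascale1 ascaleDr ascaleDl.

End Lmodule.

Definition apositive E (T : 'L(E)) : Prop := exists S : 'L(E), T = acomp (adj S) S.

(* xget returns 0 when there is no such operator. *)
Definition asqrt E (T : 'L(E)) : 'L(E) :=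
  xget 0 [set S | apositive S /\ acomp S S = T].

Definition ainv E (T : 'L(E)) : 'L(E) :=
  xget 0 [set S | acomp S T = aid E /\ acomp T S = aid E].

Definition idempotent_op E (T : 'L(E)) : Prop := acomp T T = T.

Definition projection E (T : 'L(E)) : Prop := idempotent_op T /\ adj T = T.

End Adjointable.

Infix "\oA" := acomp (at level 40, left associativity).
Arguments aid {R A} E.

Record submodule (R : realType) (A : cstarType R) (E : formModType A) :=
  Submodule {
    smcar :> set E;
    sm0 : smcar 0;
    smD : forall x y, smcar x -> smcar y -> smcar (x + y);
    smZ : forall (k : R[i]) x, smcar x -> smcar (k *: x);
    smact : forall x (a : A), smcar x -> smcar (act x a) }.

Section Submodule.
Context (R : realType) (A : cstarType R) (E : formModType A).
Context (V : submodule E).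

Definition smpred : {pred E} := fun x => `[< smcar V x >].

Lemma smpred_closed : submod_closed smpred.
Proof.
split; first exact/asboolP/sm0.
by move=> k x y /asboolP Vx /asboolP Vy; apply/asboolP/smD => //; apply: smZ.
Qed.

HB.instance Definition _ := GRing.isSubmodClosed.Build R[i] E smpred smpred_closed.

Record smtype := Smtype { smval :> E; smvalP : smval \in smpred }.

HB.instance Definition _ := [isSub for smval].
HB.instance Definition _ := [Choice of smtype by <:].
HB.instance Definition _ := [SubChoice_isSubLmodule of smtype by <:].

Definition smin (x : E) (Vx : smcar V x) : smtype := Smtype (asboolT Vx : x \in smpred).

Lemma smvalV (x : smtype) : smcar V (smval x).
Proof. exact/asboolP/smvalP. Qed.

Definition sm_act (x : smtype) (a : A) : smtype := smin (smact a (smvalV x)).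
Definition sm_form (x y : smtype) : A := <|smval x, smval y|>.

Fact sm_actDl x y a : sm_act (x + y) a = sm_act x a + sm_act y a.
Proof. by apply: val_inj; rewrite /= actDl. Qed.
Fact sm_actDr x a b : sm_act x (a + b) = sm_act x a + sm_act x b.
Proof. by apply: val_inj; rewrite /= actDr. Qed.
Fact sm_actM x a b : sm_act x (cmul a b) = sm_act (sm_act x a) b.
Proof. by apply: val_inj; rewrite /= actM. Qed.
Fact sm_actZl (k : R[i]) x a : sm_act (k *: x) a = k *: sm_act x a.
Proof. by apply: val_inj; rewrite /= actZl. Qed.
Fact sm_actZr (k : R[i]) x a : sm_act x (k *: a) = k *: sm_act x a.
Proof. by apply: val_inj; rewrite /= actZr. Qed.
Fact sm_formDr x y z : sm_form x (y + z) = sm_form x y + sm_form x z.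
Proof. exact: formDr. Qed.
Fact sm_formZr (k : R[i]) x y : sm_form x (k *: y) = k *: sm_form x y.
Proof. exact: formZr. Qed.
Fact sm_form_act x y a : sm_form x (sm_act y a) = cmul (sm_form x y) a.
Proof. exact: form_act. Qed.
Fact sm_form_star x y : cstar (sm_form x y) = sm_form y x.
Proof. exact: form_star. Qed.

HB.instance Definition _ := Lmodule_isForm.Build R A smtype
  sm_actDl sm_actDr sm_actM sm_actZl sm_actZr
  sm_formDr sm_formZr sm_form_act sm_form_star.

End Submodule.

Section DirectSum.
Context (R : realType) (A : cstarType R) (E F : formModType A).

Definition dsum : Type := (E * F)%type.

HB.instance Definition _ := GRing.Lmodule.on dsum.

Definition ds_act (x : dsum) (a : A) : dsum := (act x.1 a, act x.2 a).
Definition ds_form (x y : dsum) : A := <|x.1, y.1|> + <|x.2, y.2|>.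

Fact ds_actDl x y a : ds_act (x + y) a = ds_act x a + ds_act y a.
Proof. by rewrite /ds_act /= !actDl. Qed.
Fact ds_actDr x a b : ds_act x (a + b) = ds_act x a + ds_act x b.
Proof. by rewrite /ds_act !actDr. Qed.
Fact ds_actM x a b : ds_act x (cmul a b) = ds_act (ds_act x a) b.
Proof. by rewrite /ds_act !actM. Qed.
Fact ds_actZl (k : R[i]) x a : ds_act (k *: x) a = k *: ds_act x a.
Proof. by rewrite /ds_act /= !actZl. Qed.
Fact ds_actZr (k : R[i]) x a : ds_act x (k *: a) = k *: ds_act x a.
Proof. by rewrite /ds_act !actZr. Qed.
Fact ds_formDr x y z : ds_form x (y + z) = ds_form x y + ds_form x z.
Proof. by rewrite /ds_form /= !formDr addrACA. Qed.
Fact ds_formZr (k : R[i]) x y : ds_form x (k *: y) = k *: ds_form x y.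
Proof. by rewrite /ds_form /= !formZr scalerDr. Qed.
Fact ds_form_act x y a : ds_form x (ds_act y a) = cmul (ds_form x y) a.
Proof. by rewrite /ds_form /= !form_act cmulDl. Qed.
Fact ds_form_star x y : cstar (ds_form x y) = ds_form y x.
Proof. by rewrite /ds_form cstarD !form_star. Qed.

HB.instance Definition _ := Lmodule_isForm.Build R A dsum
  ds_actDl ds_actDr ds_actM ds_actZl ds_actZr
  ds_formDr ds_formZr ds_form_act ds_form_star.

Section Block.
Context (T11 : 'L(E)) (T12 : 'L(F, E)) (T21 : 'L(E, F)) (T22 : 'L(F)).

Lemma block_subproof (x y : dsum) :
  <|((T11 x.1 + T12 x.2, T21 x.1 + T22 x.2) : dsum), y|> =
  <|x, ((aadj T11 y.1 + aadj T21 y.2, aadj T12 y.1 + aadj T22 y.2) : dsum)|>.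
Proof.
rewrite -[LHS]/(ds_form _ _) -[RHS]/(ds_form _ _) /ds_form /=.
by rewrite !formDl !formDr !aadjP addrACA.
Qed.

Definition block : 'L(dsum) := Adjointable block_subproof.

End Block.
End DirectSum.

Section HilbertTheory.
Context (R : realType) (A : cstarType R) (H : hilbertModType A).
Implicit Types (x y : H) (T : 'L(H)).

Lemma form_inj x y : (forall z : H, <|z, x|> = <|z, y|> :> A) -> x = y.
Proof.
move=> xy; apply/eqP; rewrite -subr_eq0 -normr_eq0 -sqrf_eq0 form_norm.
by rewrite formDr formNr xy subrr normr0.
Qed.

Lemma afunD T x y : T (x + y) = T x + T y.
Proof. by apply: form_inj => z; rewrite formDr -!aadjP' formDr. Qed.

Lemma afunZ T (k : R[i]) x : T (k *: x) = k *: T x.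
Proof. by apply: form_inj => z; rewrite formZr -!aadjP' formZr. Qed.

Lemma afun_act T x (a : A) : T (act x a) = act (T x) a.
Proof. by apply: form_inj => z; rewrite form_act -!aadjP' form_act. Qed.

Lemma afun0 T : T 0 = 0.
Proof. by apply: (addrI (T 0)); rewrite -afunD !addr0. Qed.

Section RangeKernel.
Context (T : 'L(H)).

Fact ran0 : range T 0.
Proof. by exists 0 => //; exact: afun0. Qed.
Fact ranD x y : range T x -> range T y -> range T (x + y).
Proof. by move=> [u _ <-] [v _ <-]; exists (u + v) => //; exact: afunD. Qed.
Fact ranZ (k : R[i]) x : range T x -> range T (k *: x).
Proof. by move=> [u _ <-]; exists (k *: u) => //; exact: afunZ. Qed.
Fact ran_act x (a : A) : range T x -> range T (act x a).
Proof. by move=> [u _ <-]; exists (act u a) => //; exact: afun_act. Qed.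

Definition ran : submodule H := Submodule ran0 ranD ranZ ran_act.

Let kerT : set H := [set x | T x = 0].

Fact ker0 : kerT 0.
Proof. exact: afun0. Qed.
Fact kerD x y : kerT x -> kerT y -> kerT (x + y).
Proof. by rewrite /kerT/= afunD => -> ->; rewrite addr0. Qed.
Fact kerZ (k : R[i]) x : kerT x -> kerT (k *: x).
Proof. by rewrite /kerT/= afunZ => ->; rewrite scaler0. Qed.
Fact ker_act x (a : A) : kerT x -> kerT (act x a).
Proof. by rewrite /kerT/= afun_act => ->; rewrite act0l. Qed.

Definition ker : submodule H := Submodule ker0 kerD kerZ ker_act.

End RangeKernel.

Definition proj_onto (V : submodule H) (P : 'L(H)) : Prop :=
  projection P /\ range P = V.

End HilbertTheory.

Section MatchedProjection.
Context (R : realType) (A : cstarType R) (H : hilbertModType A).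
Context (Q : 'L(H)) (idQ : idempotent_op Q).
Context (P : 'L(H)) (PQ : proj_onto (ran Q) P).

Let idP x : P (P x) = P x.
Proof. by have [[pp _] _] := PQ; rewrite -[in RHS]pp. Qed.

Let saP x : aadj P x = P x.
Proof. by have [[_ pa] _] := PQ; rewrite -[in RHS]pa. Qed.

Let idQE x : Q (Q x) = Q x.
Proof. by rewrite -[in RHS]idQ. Qed.

Let PQE x : P (Q x) = Q x.
Proof.
have [_ rP] := PQ; have [y _ <-] : range P (Q x) by rewrite rP; exists x.
exact: idP.
Qed.

Let ranP x : smcar (ran Q) (P x).
Proof. by have [_ rP] := PQ; rewrite -rP; exists x. Qed.

Let P_id x : smcar (ran Q) x -> P x = x.
Proof. by move=> [y _ <-]; exact: PQE. Qed.

Let kerP x : smcar (ker (adj Q)) ((aid H - P) x).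
Proof.
apply: form_inj => z; rewrite formx0 /= -aadjP formDr formNr.
by rewrite -[in X in _ - X]saP -aadjP PQE subrr.
Qed.

Let P_ker x : smcar (ker (adj Q)) x -> P x = 0.
Proof.
move=> Qx; apply: form_inj => z; rewrite formx0 -saP -aadjP.
by have [y _ <-] := ranP z; rewrite aadjP [aadj Q x]Qx formx0.
Qed.

Let RQ : formModType A := smtype (ran Q).
Let NQ : formModType A := smtype (ker (adj Q)).
Let I1 : 'L(RQ) := aid RQ.

Definition mpU_fun (h : H) : dsum RQ NQ := (smin (ranP h), smin (kerP h)).

Lemma mpU_subproof (h : H) (z : dsum RQ NQ) :
  <|mpU_fun h, z|> = <|h, smval z.1 + smval z.2|>.
Proof.
rewrite -[LHS]/(ds_form _ _) /ds_form -[LHS]/(<|P h, _|> + <|h - P h, _|>).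
case: z => -[x x_in] [y y_in] /=; move/asboolP: x_in; move/asboolP: y_in.
move=> y_in x_in; rewrite formDl formNl !aadjP !saP (P_id x_in) (P_ker y_in).
by rewrite formx0 subr0 formDr.
Qed.

Definition mpU : 'L(H, dsum RQ NQ) := Adjointable mpU_subproof.

Let mpA_ran (x : NQ) : smcar (ran Q) ((Q - P) (smval x)).
Proof.
have -> : (Q - P) (smval x) = Q (smval x) + - 1 *: P (smval x).
  by rewrite scaleN1r.
by apply: smD; [exists (smval x)|apply: smZ].
Qed.

Let mpA_ker (y : RQ) : smcar (ker (adj Q)) ((adj Q - P) (smval y)).
Proof.
apply: form_inj => z; rewrite formx0 /= -aadjP formDr formNr.
by rewrite -aadjP idQE -[in X in _ - X]saP -aadjP PQE subrr.
Qed.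

Lemma mpA_subproof (x : NQ) (y : RQ) :
  <|(smin (mpA_ran x) : RQ), y|> = <|x, (smin (mpA_ker y) : NQ)|>.
Proof.
transitivity <|Q (smval x) - P (smval x), smval y|>; first by [].
by rewrite formDl formNl !aadjP saP -formNr -formDr.
Qed.

Definition mpA : 'L(NQ, RQ) := Adjointable mpA_subproof.

Definition mpB : 'L(RQ) := asqrt (mpA \oA adj mpA + I1).

Definition matched_block : 'L(H) :=
  adj mpU \oA
  (2^-1 *: block ((mpB + I1) \oA ainv mpB)       (ainv mpB \oA mpA)
                 (adj mpA \oA ainv mpB)
                 (adj mpA \oA ainv (mpB \oA (mpB + I1)) \oA mpA))
  \oA mpU.

End MatchedProjection.

(* The projection P onto the range of Q is unique and exists for every idempotent
   Q; the value is irrelevant when Q is not idempotent. *)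
Definition matched (R : realType) (A : cstarType R) (H : hilbertModType A)
    (Q : 'L(H)) : 'L(H) :=
  if `[< projection Q >] then Q else
  xget 0 [set M | exists (idQ : idempotent_op Q) (P : 'L(H))
                    (PQ : proj_onto (ran Q) P), M = matched_block idQ PQ].

(* Main.v *)
(** Put [G = Q + adj Q - 1] and let [K] be the positive square root of [G^2].
    In the decomposition of [H] into the range of [Q] and the kernel of [adj Q]
    the operator [K] is block diagonal with first entry [B], and multiplying
    out the blocks gives [m(Q) = (1 + K^-1 G) / 2], which is symmetric in [Q]
    and [adj Q].

    As [G^2 = 1 + h^2] with [h = i (Q - adj Q)] self-adjoint, the existence of
    [K] and of its inverse only needs the positivity of squares: if [|h| < 1]
    and [s] is a square root of [1 - h^2], then [u = h + i s] is unitary and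
    [2 h^2 - 1] is the real part of [u^2].  Square roots and inverses are limits
    of geometrically converging sequences of polynomials, hence lie in the
    bicommutant.

    The uniqueness of the positive square root [B] comes down to the fact that
    [adj y * y = - p] with [p] a projection forces [p = 0]. *)

From HB Require Import structures.
From mathcomp Require Import all_boot all_order all_algebra.
From mathcomp Require Import complex.
From mathcomp Require Import all_classical all_reals all_analysis.
From mathcomp Require Import lra ring.
Require Import Defs.

Set Implicit Arguments.
Unset Strict Implicit.
Unset Printing Implicit Defensive.
Import Order.TTheory GRing.Theory Num.Theory.
Import numFieldNormedType.Exports.
Local Open Scope classical_set_scope.
Local Open Scope ring_scope.
Local Open Scope complex_scope.

(** * Real-valued norms and geometrically converging sequences *)

Section RealNorm.
Context (R : realType) (V : normedModType R[i]).
Implicit Types x y : V.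

(** Norms over [R[i]] are complex numbers with zero imaginary part; as elements of [R] they are
    within reach of [lra] and [nra]. *)
Definition rnorm x : R := complex.Re `|x|.

Lemma rnormE x : `|x| = (rnorm x)%:C.
Proof.
have := normr_ge0 x; rewrite /rnorm lecE /= => /andP[/eqP + _].
by case: `|x| => a b /= ->.
Qed.

Lemma rnorm_ge0 x : 0 <= rnorm x.
Proof. by rewrite -lecR -rnormE normr_ge0. Qed.

Lemma rnormD x y : rnorm (x + y) <= rnorm x + rnorm y.
Proof. by rewrite -lecR rmorphD /= -!rnormE ler_normD. Qed.

Lemma rnormN x : rnorm (- x) = rnorm x.
Proof. by rewrite /rnorm normrN. Qed.

Lemma rnormB x y : rnorm (x - y) <= rnorm x + rnorm y.
Proof. by rewrite (le_trans (rnormD _ _)) ?rnormN. Qed.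

Lemma rnorm0 : rnorm (0 : V) = 0.
Proof. by rewrite /rnorm normr0. Qed.

Lemma rnormZ (k : R[i]) x : rnorm (k *: x) = complex.Re `|k| * rnorm x.
Proof.
rewrite /rnorm normrZ rnormE normc_def /=; ring.
Qed.

Lemma rnormZr (k : R) x : rnorm (k%:C *: x) = `|k| * rnorm x.
Proof. by rewrite rnormZ normc_def /= expr0n /= addr0 sqrtr_sqr. Qed.

Lemma rnorm_eq0 x : rnorm x = 0 -> x = 0.
Proof. by move=> x0; apply/eqP; rewrite -normr_eq0 rnormE x0. Qed.

Lemma rnorm_le0 x : rnorm x <= 0 -> x = 0.
Proof. by move=> x0; apply: rnorm_eq0; apply/le_anti; rewrite x0 rnorm_ge0. Qed.
End RealNorm.

Lemma geometric_small (R : realType) (C c : R) : 0 <= c < 1 ->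
  forall e : R, 0 < e -> exists n : nat, C * c ^+ n < e.
Proof.
move=> /andP[c0 c1] e e0.
have := @cvg_geometric R C c; rewrite ger0_norm//.
move=> /(_ c1)/cvgrPdist_lt/(_ e e0).
case=> n _ /(_ n (leqnn n)) /=; rewrite sub0r normrN.
by move=> /(le_lt_trans (ler_norm _)); exists n.
Qed.

Lemma geometric_limit (R : realType) (V : completeNormedModType R[i])
    (u : nat -> V) (C c : R) : 0 <= C -> 0 <= c < 1 ->
  (forall n, rnorm (u n.+1 - u n) <= C * c ^+ n) ->
  exists l : V, forall n, rnorm (l - u n) <= C / (1 - c) * c ^+ n.
Proof.
move=> C0 c01 uC; have /andP[c0 c1] := c01.
have c1' : 0 < 1 - c by lra.
(* The factor [1 - c ^+ m] closes the induction: the new step [C * c ^+ (n + m)] turns it into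
   [1 - c ^+ m.+1]. *)
have D n m : rnorm (u (n + m)%N - u n) <= C / (1 - c) * c ^+ n * (1 - c ^+ m).
  elim: m => [|m IH]; first by rewrite addn0 subrr rnorm0 expr0 subrr mulr0.
  have -> : u (n + m.+1)%N - u n =
      (u (n + m).+1 - u (n + m)%N) + (u (n + m)%N - u n).
    by rewrite addnS addrA subrK.
  apply: le_trans (rnormD _ _) _; apply: le_trans (lerD (uC _) IH) _.
  rewrite exprD exprS le_eqVlt; apply/orP; left; apply/eqP; field.
  by rewrite gt_eqF.
have D' n m : rnorm (u (n + m)%N - u n) <= C / (1 - c) * c ^+ n.
  apply: le_trans (D n m) _; rewrite ler_piMr//.
    by rewrite !mulr_ge0 ?exprn_ge0 ?invr_ge0 ?(ltW c1').
  by rewrite gerBl exprn_ge0.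
have : cvg (u @ \oo).
  apply/cauchy_cvgP/cauchy_exP => e e0.
  move: (e0); rewrite ltcE /= => /andP[/eqP ei e0'].
  have [n ne] := @geometric_small R (C / (1 - c)) c c01 _ e0'.
  exists (u n); exists n => // m /= nm.
  rewrite -ball_normE /ball_ /= distrC.
  rewrite rnormE ltcE /= ei eqxx /=.
  by rewrite -(subnKC nm) (le_lt_trans (D' _ _)) ?ne.
move=> /cvgrPdist_lt ul; exists (lim (u @ \oo)) => n.
apply/ler_addgt0Pr => e e0.
have [|N _ Nu] := ul (e%:C); first by rewrite ltcR.
have := Nu (N + n)%N (leq_addr _ _); rewrite /= rnormE ltcR => /ltW le.
rewrite -(subrK (u (N + n)%N) (lim _)) -addrA addrC.
apply: le_trans (rnormD _ _) _; apply: lerD => //.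
by rewrite addnC D'.
Qed.

Lemma conj_real (R : realType) (k : R) : Num.conj (k%:C) = k%:C.
Proof. by apply/eqP; rewrite eq_complex /= oppr0 !eqxx. Qed.

Lemma conj_i (R : realType) : Num.conj 'i = - 'i :> R[i].
Proof. by apply/eqP; rewrite eq_complex /= oppr0 !eqxx. Qed.

(** * The ring of adjointable operators on [H] and its involution *)

Section OperatorAlgebra.
Context (R : realType) (A : cstarType R) (H : hilbertModType A).
Implicit Types S T U : 'L(H).

(** Definiteness of the inner product makes the adjoint unique, so the packed adjoints agree as soon
    as the maps do. *)
Lemma op_ext S T : S =1 T -> S = T.
Proof.
move=> ST; apply: adjointable_eq => // x; apply: form_inj => z.
by rewrite -!aadjP ST.
Qed.

Fact acompA : associative (@acomp R A H H H).
Proof. by move=> S T U; apply: adjointable_eq. Qed.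
Fact acomp1l : left_id (aid H) (@acomp R A H H H).
Proof. by move=> S; apply: adjointable_eq. Qed.
Fact acomp1r : right_id (aid H) (@acomp R A H H H).
Proof. by move=> S; apply: adjointable_eq. Qed.
Fact acompDl : left_distributive (@acomp R A H H H) +%R.
Proof. by move=> S T U; apply: op_ext. Qed.
Fact acompDr : right_distributive (@acomp R A H H H) +%R.
Proof. by move=> S T U; apply: op_ext => x; exact: afunD. Qed.

HB.instance Definition _ := GRing.Zmodule_isPzRing.Build 'L(H)
  acompA acomp1l acomp1r acompDl acompDr.

Lemma opE_mul S T x : (S * T) x = S (T x). Proof. by []. Qed.
Lemma opE_add S T x : (S + T) x = S x + T x. Proof. by []. Qed.
Lemma opE_opp S x : (- S) x = - S x. Proof. by []. Qed.
Lemma opE_scale (k : R[i]) S x : (k *: S) x = k *: S x. Proof. by []. Qed.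
Lemma opE_one (x : H) : (1 : 'L(H)) x = x. Proof. by []. Qed.
Lemma opE_zero (x : H) : (0 : 'L(H)) x = 0. Proof. by []. Qed.

Definition opE := (opE_mul, opE_add, opE_opp, opE_scale, opE_one, opE_zero).

Fact ascaleAl (k : R[i]) S T : k *: (S * T) = k *: S * T.
Proof. exact: op_ext. Qed.
Fact ascaleAr (k : R[i]) S T : k *: (S * T) = S * (k *: T).
Proof. by apply: op_ext => x; rewrite !opE afunZ. Qed.

Lemma adjK S : adj (adj S) = S. Proof. exact: op_ext. Qed.
Lemma adjM S T : adj (S * T) = adj T * adj S. Proof. exact: op_ext. Qed.
Lemma adjD S T : adj (S + T) = adj S + adj T. Proof. exact: op_ext. Qed.
Lemma adjN S : adj (- S) = - adj S. Proof. exact: op_ext. Qed.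
Lemma adjB S T : adj (S - T) = adj S - adj T. Proof. exact: op_ext. Qed.
Lemma adjZ (k : R[i]) S : adj (k *: S) = Num.conj k *: adj S.
Proof. exact: op_ext. Qed.
Lemma adj1 : adj (1 : 'L(H)) = 1. Proof. exact: op_ext. Qed.
Lemma adj0 : adj (0 : 'L(H)) = 0. Proof. exact: op_ext. Qed.

Lemma afunN T x : T (- x) = - T x.
Proof. by rewrite -scaleN1r afunZ scaleN1r. Qed.
End OperatorAlgebra.

(** * Polarization and a weak Cauchy-Schwarz inequality *)

Section FormNorm.
Context (R : realType) (A : cstarType R) (H : hilbertModType A).
Implicit Types x y : H.

Lemma rnorm_form x : rnorm (<|x, x|> : A) = rnorm x ^+ 2.
Proof. by apply: complexI; rewrite -rnormE -form_norm rnormE -rmorphXn. Qed.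

Lemma rnorm_isometric x y : <|x, x|> = <|y, y|> :> A -> rnorm x = rnorm y.
Proof.
move=> xy; apply/eqP; rewrite -(@eqrXn2 _ 2) ?rnorm_ge0//.
by rewrite -!rnorm_form xy.
Qed.

Lemma form_parallelogram x y :
  <|x + y, x + y|> - <|x - y, x - y|> = (<|x, y|> + <|y, x|>) *+ 2 :> A.
Proof.
rewrite !formDr !formDl !formNr !formNl opprK.
move: <|x, x|> <|x, y|> <|y, x|> <|y, y|> => a b c d.
rewrite (AC (2*2) ((1*4)*(3*2))) /= [X in _ - X](AC (2*2) ((1*4)*(3*2))) /=.
rewrite -[- b - c]opprD opprB [b + c - _]addrC.
rewrite [LHS]addrACA subrr add0r.
by rewrite -mulr2n.
Qed.

(** Half of the right-hand side is the sum of [<|x, y|> + <|y, x|>] and, from ['i *: y], of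
    [<|x, y|> - <|y, x|>]. *)
Lemma polarization x y : 4%:R *: (<|x, y|> : A) =
  <|x + y, x + y|> - <|x - y, x - y|>
  - 'i *: (<|x + 'i *: y, x + 'i *: y|> - <|x - 'i *: y, x - 'i *: y|>).
Proof.
rewrite !form_parallelogram formZl formZr conj_i.
rewrite -scalerMnr scalerDr scaleNr !scalerN !scalerA -expr2 sqrCi.
rewrite !scaleN1r opprK -mulrnBl opprD opprK addrACA subrr addr0.
by rewrite scaler_nat -mulr2n -mulrnA.
Qed.

(* The constant [1] needs the order of [A], the constant [4] only the triangle
   inequality. *)
Lemma form_bound x y : rnorm (<|x, y|> : A) <= 4%:R * (rnorm x * rnorm y).
Proof.
have S (u v : H) : rnorm (<|u, v|> : A) <= (rnorm u + rnorm v) ^+ 2.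
  have D (k : R[i]) : `|k| = 1 -> rnorm (<|u + k *: v, u + k *: v|> : A)
      <= (rnorm u + rnorm v) ^+ 2.
    move=> k1; rewrite rnorm_form ler_sqr ?nnegrE ?addr_ge0 ?rnorm_ge0//.
    by apply: le_trans (rnormD _ _) _; rewrite rnormZ k1 mul1r.
  have := D 1; rewrite normr1 scale1r => /(_ erefl) D1.
  have := D (-1); rewrite normrN1 scaleN1r => /(_ erefl) D2.
  have i1 : `|'i| = 1 :> R[i].
    by rewrite normc_def /= expr0n expr1n add0r sqrtr1.
  have D3 := D 'i i1.
  have := D (- 'i); rewrite normrN scaleNr => /(_ i1) D4.
  have : rnorm (4%:R *: (<|u, v|> : A)) <= 4 * (rnorm u + rnorm v) ^+ 2.
    rewrite polarization; apply: le_trans (rnormB _ _) _.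
    rewrite rnormZ i1 mul1r.
    have := rnormB (<|u + v, u + v|> : A) <|u - v, u - v|>.
    have := rnormB (<|u + 'i *: v, u + 'i *: v|> : A)
      <|u - 'i *: v, u - 'i *: v|>.
    lra.
  have -> : 4%:R = (4%:R)%:C :> R[i] by rewrite rmorph_nat.
  by rewrite rnormZr ger0_norm// ler_pM2l.
have [->|x0] := eqVneq x 0; first by rewrite form0x !rnorm0 mul0r mulr0.
have [->|y0] := eqVneq y 0; first by rewrite formx0 !rnorm0 !mulr0.
have pos (z : H) : z != 0 -> 0 < rnorm z.
  move=> z0; rewrite lt_def rnorm_ge0 andbT.
  by apply: contra z0 => /eqP/rnorm_eq0 ->.
have px := pos _ x0; have py := pos _ y0.
(* On unit vectors the bound [S] is [(1 + 1) ^+ 2 = 4]; scaling back gives the general case. *)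
have := S ((rnorm x)^-1%:C *: x) ((rnorm y)^-1%:C *: y).
rewrite formZl formZr conj_real !rnormZr !gtr0_norm ?invr_gt0//.
rewrite !mulVf ?gt_eqF// mulrA -invfM mulrC.
rewrite ler_pdivrMr ?mulr_gt0// => /le_trans; apply.
by rewrite [_ ^+ 2](_ : _ = 4) //; ring.
Qed.

End FormNorm.

(** Passage to the limit: identities between limits are reduced below to one estimate with a
    geometric error. *)
Lemma geometric_le0 (R : realType) (a C c : R) : 0 <= c < 1 ->
  (forall n, a <= C * c ^+ n) -> a <= 0.
Proof.
move=> c01 aC; rewrite leNgt; apply/negP => a0.
by have [n] := geometric_small C c01 a0; rewrite ltNge aC.
Qed.

(** * Operator bounds and automatic boundedness *)

Section OperatorBound.
Context (R : realType) (A : cstarType R) (H : hilbertModType A).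
Implicit Types (S T U : 'L(H)) (x y : H) (c d : R).

Definition opbound T c := forall x, rnorm (T x) <= c * rnorm x.

Lemma opbound_le T c d : c <= d -> opbound T c -> opbound T d.
Proof. by move=> cd Tc x; rewrite (le_trans (Tc x)) ?ler_wpM2r ?rnorm_ge0. Qed.

Lemma opboundD S T c d : opbound S c -> opbound T d -> opbound (S + T) (c + d).
Proof.
by move=> Sc Td x; rewrite mulrDl (le_trans (rnormD _ _)) ?lerD ?Sc ?Td.
Qed.

Lemma opboundN T c : opbound T c -> opbound (- T) c.
Proof. by move=> Tc x; rewrite opE rnormN. Qed.

Lemma opboundB S T c d : opbound S c -> opbound T d -> opbound (S - T) (c + d).
Proof. by move=> Sc Td; apply/opboundD/opboundN. Qed.

Lemma opboundM S T c d :
  0 <= c -> opbound S c -> opbound T d -> opbound (S * T) (c * d).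
Proof.
by move=> c0 Sc Td x; rewrite -mulrA (le_trans (Sc _)) ?ler_wpM2l ?Td.
Qed.

Lemma opboundZ (k : R) T c : opbound T c -> opbound (k%:C *: T) (`|k| * c).
Proof. by move=> Tc x; rewrite opE rnormZr -mulrA ler_wpM2l. Qed.

Lemma opbound0 : opbound 0 0.
Proof. by move=> x; rewrite opE rnorm0 mul0r. Qed.

Lemma opbound1 : opbound 1 1.
Proof. by move=> x; rewrite opE mul1r. Qed.

Lemma opbound_geometric T C c : 0 <= c < 1 ->
  (forall n, opbound T (C * c ^+ n)) -> T = 0.
Proof.
move=> c01 TC; apply: op_ext => x; apply: rnorm_le0.
apply: (@geometric_le0 _ _ (C * rnorm x) _ c01) => n.
by rewrite mulrAC TC.
Qed.

(* A gliding hump.  If [T] is unbounded, pick [y n] with [T (y n)] much longer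
   than [y n], and let [u] make steps of size [16^-n] so that
   [x |-> <|T (y n), x|> = <|y n, T^* x|>] is large along [u]. *)
Lemma adjointable_bounded T : exists2 c, 0 <= c & opbound T c.
Proof.
apply: contrapT => Tunb.
have [y Ty] : {y : nat -> H & forall n,
    32%:R ^+ n * rnorm (y n) < rnorm (T (y n))}.
  apply: (@choice _ _ (fun n z => 32%:R ^+ n * rnorm z < rnorm (T z))) => n.
  apply: contrapT => nT; apply: Tunb; exists (32%:R ^+ n).
    exact: exprn_ge0.
  by move=> x; rewrite leNgt; apply/negP => Tx; apply: nT; exists x.
have Ty0 n : 0 < rnorm (T (y n)).
  by apply: le_lt_trans (Ty n); rewrite mulr_ge0 ?exprn_ge0 ?rnorm_ge0.
pose e n : R := 16%:R^-1 ^+ n.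
have e0 n : 0 <= e n by rewrite exprn_ge0.
have [s sP] : {s : nat * H -> H & forall p, rnorm (s p - p.2) <= e p.1 /\
    e p.1 * rnorm (T (y p.1)) <= rnorm (<|T (y p.1), s p|> : A)}.
  apply: (@choice _ _ (fun p z => rnorm (z - p.2) <= e p.1 /\
    e p.1 * rnorm (T (y p.1)) <= rnorm (<|T (y p.1), z|> : A))) => -[n x] /=.
  set w := T (y n); pose z := (e n / rnorm w)%:C *: w.
  have w0 : rnorm w != 0 by rewrite gt_eqF ?Ty0.
  have zE : rnorm z = e n.
    by rewrite rnormZr ger0_norm ?divr_ge0 ?rnorm_ge0 ?divfK.
  have wz : rnorm (<|w, z|> : A) = e n * rnorm w.
    rewrite formZr rnormZr ger0_norm ?divr_ge0 ?rnorm_ge0// rnorm_form.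
    by rewrite expr2 mulrA divfK.
  (* One of [x + z] and [x - z] works, because the values of [<|w, _|>] at these points differ by
     [2 <|w, z|>]. *)
  have [le|gt] := leP (e n * rnorm w) (rnorm (<|w, x + z|> : A)).
    by exists (x + z); rewrite [x + z - x]addrC addKr zE.
  exists (x - z); rewrite [x - z - x]addrC addKr rnormN zE; split=> //.
  have : rnorm ((2%:R)%:C *: (<|w, z|> : A)) <=
      rnorm (<|w, x + z|> : A) + rnorm (<|w, x - z|> : A).
    apply: le_trans (rnormB _ _).
    rewrite !formDr formNr opprD opprK addrACA subrr add0r.
    by rewrite rmorph_nat scaler_nat mulr2n.
  rewrite rnormZr wz normr_nat; lra.
pose u := fix u n := if n is m.+1 then s (m, u m) else 0.
have [|n|l ul] := @geometric_limit R H u 1 16%:R^-1 ler01.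
- by apply/andP; split; lra.
- by rewrite mul1r; have [] := sP (n, u n).
pose L := rnorm (aadj T l).
have half : 0 <= (2%:R^-1 : R) < 1 by apply/andP; split; lra.
(* So [8 L < 2^n]. Then [4 L |y n| <= e n |w| / 2], and the tail of [u] after [n.+1] is at most
   [e n / 15]. As [1/2 + 4/15 < 1], the lower bound [e n |w|] of [|<|w, u n.+1|>|] is
   contradicted. *)
have [n nL] := geometric_small (8%:R * L) half ltr01.
have [_ /=] := sP (n, u n); set w := T (y n) => le1.
have le2 : rnorm (<|w, u n.+1|> : A) <= 4%:R * (rnorm (y n) * L)
    + 4%:R * (rnorm w * rnorm (l - u n.+1)).
  have -> : <|w, u n.+1|> = <|w, l|> - <|w, l - u n.+1|> :> A.
    by rewrite -formNr -formDr opprB addrC subrK.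
  by rewrite (le_trans (rnormB _ _))// lerD ?form_bound// aadjP form_bound.
have le3 := ul n.+1.
have e32 : e n * 32%:R ^+ n = 2%:R ^+ n by rewrite -exprMn; congr (_ ^+ _); lra.
have en0 : 0 < e n by rewrite exprn_gt0 ?invr_gt0.
have le4 : 2%:R ^+ n * rnorm (y n) < e n * rnorm w.
  by rewrite -e32 -mulrA ltr_pM2l.
have le5 : 8%:R * L * rnorm (y n) <= 2%:R ^+ n * rnorm (y n).
  rewrite ler_wpM2r ?rnorm_ge0//.
  by move: nL; rewrite exprVn ltr_pdivrMr// mul1r => /ltW.
have le6 : rnorm w * rnorm (l - u n.+1) <= rnorm w * (e n / 15%:R).
  rewrite ler_wpM2l ?rnorm_ge0// (le_trans le3)//.
  by rewrite exprS -/(e n) le_eqVlt; apply/orP; left; apply/eqP; field.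
have eW : 0 < e n * rnorm w by rewrite mulr_gt0// Ty0.
move: le1 le2; rewrite /= => le1 /(le_trans le1) le2.
lra.
Qed.
End OperatorBound.

(** * Square roots and inverses of strictly positive operators *)

Section PositiveOperators.
Context (R : realType) (A : cstarType R) (H : hilbertModType A).
Implicit Types (S T U V X : 'L(H)) (x y : H) (c d k : R).

Lemma opbound_limit (T : nat -> 'L(H)) S C c d : 0 <= c < 1 ->
  (forall n, opbound (S - T n) (C * c ^+ n)) ->
  (forall n, opbound (T n) d) -> opbound S d.
Proof.
move=> c01 ST Td x; rewrite -subr_le0.
apply: (@geometric_le0 _ _ (C * rnorm x) _ c01) => n.
have := lerD (ST n x) (Td n x); rewrite opE.
have := rnormD ((S - T n) x) (T n x); rewrite !opE subrK; lra.
Qed.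

(** The limit is taken pointwise in [H]. By [form_bound] it is symmetric, hence adjointable with
    itself as adjoint. Commutation with [V] survives because [V] is bounded. *)
Lemma selfadjoint_limit (T : nat -> 'L(H)) C c : 0 <= C -> 0 <= c < 1 ->
  (forall n, adj (T n) = T n) ->
  (forall n, opbound (T n.+1 - T n) (C * c ^+ n)) ->
  exists S, [/\ adj S = S,
    forall n, opbound (S - T n) (C / (1 - c) * c ^+ n) &
    forall V, (forall n, T n * V = V * T n) -> S * V = V * S].
Proof.
move=> C0 c01 Ta TC; set D := C / (1 - c).
have [f fP] : {f : H -> H & forall x n,
    rnorm (f x - T n x) <= D * c ^+ n * rnorm x}.
  apply: (@choice _ _ (fun x z => forall n, rnorm (z - T n x) <= _)) => x.
  have [|n|l lP] := @geometric_limit R H (T^~ x) (C * rnorm x) c _ c01.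
  - by rewrite mulr_ge0 ?rnorm_ge0.
  - by rewrite mulrAC; apply: TC.
  by exists l => n; have := lP n; congr (_ <= _); rewrite /D; ring.
have f_sym x y : <|f x, y|> = <|x, f y|> :> A.
  apply/eqP; rewrite -subr_eq0; apply/eqP/rnorm_le0.
  apply: (@geometric_le0 _ _ (8%:R * D * (rnorm x * rnorm y)) _ c01) => n.
  have -> : <|f x, y|> - <|x, f y|> =
      <|f x - T n x, y|> - <|x, f y - T n y|> :> A.
    rewrite formDl formNl formDr formNr opprB -aadjP'.
    by rewrite -[aadj (T n)]/(afun (adj (T n))) Ta addrA subrK.
  apply: le_trans (rnormB _ _) _.
  have := form_bound (f x - T n x) y; have := form_bound x (f y - T n y).
  have := ler_wpM2r (rnorm_ge0 y) (fP x n).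
  have := ler_wpM2l (rnorm_ge0 x) (fP y n).
  lra.
exists (Adjointable f_sym); split; first exact: op_ext.
  by move=> n x; apply: fP.
move=> V TV; apply/eqP; rewrite -subr_eq0; apply/eqP.
have [b b0 Vb] := adjointable_bounded V.
apply: (@opbound_geometric _ _ _ _ (D * b + b * D) _ c01) => n x.
set S := Adjointable _.
have -> : S * V - V * S = (S - T n) * V - V * (S - T n).
  by rewrite mulrBl mulrBr TV opprB addrA subrK.
have STn : opbound (S - T n) (D * c ^+ n) by move=> z; apply: fP.
apply: opbound_le (opboundB (opboundM _ STn Vb) (opboundM b0 Vb STn)) x.
  by rewrite le_eqVlt; apply/orP; left; apply/eqP; ring.
by rewrite !mulr_ge0 ?exprn_ge0 ?invr_ge0 ?subr_ge0//;
  case/andP: c01 => // ? /ltW.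
Qed.

(* [(1 - Z)^2 = 1 - X] is the fixed point equation [Z = (X + Z^2) / 2]. *)
Lemma sqrt_subr1 X c : adj X = X -> 0 <= c < 1 -> opbound X c ->
  exists Z, [/\ adj Z = Z, opbound Z c, (1 - Z) * (1 - Z) = 1 - X &
    forall V, X * V = V * X -> Z * V = V * Z].
Proof.
move=> Xa c01 Xc; have /andP[c0 c1] := c01.
pose h : R[i] := (2%:R^-1)%:C.
have h2 : h + h = 1.
  by rewrite -rmorphD -[RHS](rmorph1 (real_complex R)); congr _%:C; field.
have ha (U : 'L(H)) : h *: U + h *: U = U by rewrite -scalerDl h2 scale1r.
have hN d : `|2%:R^-1 : R| * d = d / 2%:R.
  by rewrite ger0_norm ?invr_ge0// mulrC.
pose Z := fix Z n : 'L(H) := if n is m.+1 then h *: (X + Z m * Z m) else 0.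
have Za n : adj (Z n) = Z n.
  by elim: n => [|n IH] /=; rewrite ?adj0// adjZ conj_real adjD adjM Xa IH.
have Zc n : opbound (Z n) c.
  elim: n => [|n IH] /=; first exact: opbound_le (@opbound0 _ _ _).
  apply: opbound_le (opboundZ _ (opboundD Xc (opboundM c0 IH IH))).
  by rewrite hN; nra.
have ZV V n : X * V = V * X -> Z n * V = V * Z n.
  move=> XV; elim: n => [|n IH] /=; first by rewrite mul0r mulr0.
  rewrite -ascaleAl -ascaleAr mulrDl mulrDr XV -mulrA IH mulrA.
  by rewrite IH -mulrA.
(* This form of the difference of squares needs no commutation. With [|Z n| <= c] it makes each step
   of the iteration at most [c] times the previous one. *)
have ZS U V : U * U - V * V = U * (U - V) + (U - V) * V.
  by rewrite mulrBl mulrBr addrA subrK.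
have [n|S [Sa SZ SV]] := @selfadjoint_limit Z 1 c ler01 c01 Za.
  rewrite mul1r; elim: n => [|n IH].
    rewrite /= subr0 mulr0 addr0.
    by apply: opbound_le (opboundZ _ Xc); rewrite hN expr0; lra.
  have -> : Z n.+2 - Z n.+1 =
      h *: (Z n.+1 * (Z n.+1 - Z n) + (Z n.+1 - Z n) * Z n).
    by rewrite -ZS {1 2}/Z -/Z -scalerBr opprD addrACA subrr add0r.
  have cn0 : 0 <= c ^+ n by rewrite exprn_ge0.
  apply: opbound_le (opboundZ _
    (opboundD (opboundM c0 (Zc _) IH) (opboundM cn0 IH (Zc _)))).
  by rewrite hN exprS; lra.
have Sc := opbound_limit c01 SZ Zc.
exists S; split=> //; last by move=> V XV; apply: SV => n; apply: ZV.
(* As [2 Z_(n+1) = X + Z_n^2], the left-hand side is [2 (S - Z_(n+1)) - (S^2 - Z_n^2)], which is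
   geometrically small. *)
have : S + S - X - S * S = 0.
  set D := 1 / (1 - c) in SZ.
  have D0 : 0 <= D by rewrite divr_ge0// subr_ge0 ltW.
  apply: (@opbound_geometric _ _ _ _ (4%:R * D) _ c01) => n.
  have -> : S + S - X - S * S = (S - Z n.+1) + (S - Z n.+1) -
      (S * (S - Z n) + (S - Z n) * Z n).
    rewrite -ZS /= addrACA -opprD ha opprD opprB.
    by rewrite -!addrA addKr.
  have Dc0 : 0 <= D * c ^+ n by rewrite mulr_ge0 ?exprn_ge0.
  apply: opbound_le (opboundB (opboundD (SZ _) (SZ _))
    (opboundD (opboundM c0 Sc (SZ _)) (opboundM Dc0 (SZ _) (Zc _)))).
  by rewrite exprS; nra.
move=> /eqP; rewrite subr_eq0 => /eqP SS.
rewrite mulrBl mul1r mulrBr mulr1 -SS opprB addrA.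
by rewrite -[S + S - X]addrA [1 - S + _]addrA subrK addrAC addrA subrK.
Qed.

(** Strict positivity without spectra: the distance from [T] to the scalar [k] is at most [c k < k],
    so that [T = k (1 - X)] with [|X| <= c < 1]. *)
Definition spos T := adj T = T /\
  exists k c, [/\ 0 < k, 0 <= c < 1 &
    opbound (k%:C *: (1 : 'L(H)) - T) (c * k)].

Lemma spos_normalize T : spos T -> exists k c X,
  [/\ 0 < k, 0 <= c < 1, adj X = X, opbound X c & T = k%:C *: (1 - X)].
Proof.
move=> [Ta [k [c [k0 c01 Tk]]]].
exists k, c, ((k^-1)%:C *: (k%:C *: (1 : 'L(H)) - T)).
split=> //.
- by rewrite adjZ conj_real adjB adjZ conj_real adj1 Ta.
- apply: opbound_le (opboundZ _ Tk).
  by rewrite gtr0_norm ?invr_gt0// mulrCA mulVf ?mulr1// gt_eqF.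
rewrite scalerBr scalerA -rmorphM mulfV ?gt_eqF// scale1r.
by rewrite opprB addrCA subrr addr0.
Qed.

Lemma spos_scale k c Z : 0 < k -> 0 <= c < 1 -> adj Z = Z -> opbound Z c ->
  spos (k%:C *: (1 - Z)).
Proof.
move=> k0 c01 Za Zc; split; first by rewrite adjZ conj_real adjB adj1 Za.
exists k, c; split=> //.
rewrite -scalerBr opprB addrCA subrr addr0.
by apply: opbound_le (opboundZ _ Zc); rewrite gtr0_norm// mulrC.
Qed.

(** The root is [sqrt k (1 - Z)] with [|Z| <= c]. It is again strictly positive, so it has an
    inverse and a root of its own. *)
Lemma spos_sqrt T : spos T -> exists S, [/\ spos S, S * S = T &
  forall V, T * V = V * T -> S * V = V * S].
Proof.
move=> /spos_normalize[k [c [X [k0 c01 Xa Xc ->]]]].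
have [Z [Za Zc ZX ZV]] := sqrt_subr1 Xa c01 Xc.
exists ((Num.sqrt k)%:C *: (1 - Z)); split.
- by apply: (@spos_scale _ c); rewrite ?sqrtr_gt0.
- rewrite -ascaleAl -ascaleAr scalerA -rmorphM ZX.
  by rewrite -expr2 sqr_sqrtr// ltW.
move=> V; rewrite -!ascaleAl -!ascaleAr => /scalerI.
rewrite eq_complex /= gt_eqF// => /(_ erefl).
rewrite mulrBl mulrBr mul1r mulr1 => /addrI/oppr_inj/ZV ZV'.
by rewrite mulrBl mulrBr mul1r mulr1 ZV'.
Qed.

Lemma spos_inv T : spos T -> exists W, W * T = 1 /\ T * W = 1.
Proof.
move=> /spos_normalize[k [c [X [k0 c01 Xa Xc ->]]]].
(* Partial sums of the Neumann series of [(1 - X)^-1]. *)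
pose W := fix W n : 'L(H) := if n is m.+1 then 1 + X * W m else 0.
have WX n : W n * X = X * W n.
  elim: n => [|n IH] /=; first by rewrite mul0r mulr0.
  by rewrite mulrDl mulrDr mul1r mulr1 -mulrA IH.
have Wa n : adj (W n) = W n.
  elim: n => [|n IH] /=; first exact: adj0.
  by rewrite adjD adj1 adjM IH Xa WX.
have /andP[c0 c1] := c01.
have [n|S [Sa SW SV]] := @selfadjoint_limit W 1 c ler01 c01 Wa.
  rewrite mul1r; elim: n => [|n IH].
    by rewrite /= mulr0 addr0 subr0 expr0; apply: opbound1.
  rewrite [W n.+2]/= [in X in _ - X]/= opprD addrACA subrr add0r -mulrBr exprS.
  exact: opboundM.
have XS : S * X = X * S by apply: SV.
have S1 : S - (1 + X * S) = 0.
  apply: (@opbound_geometric _ _ _ _ (2%:R * (1 / (1 - c))) _ c01) => n.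
  have -> : S - (1 + X * S) = (S - W n.+1) - X * (S - W n).
    by rewrite /= mulrBr opprB !opprD !addrA subrK.
  apply: opbound_le (opboundB (SW _) (opboundM c0 Xc (SW _))).
  have : 0 <= 1 / (1 - c) * c ^+ n.
    by rewrite mulr_ge0 ?exprn_ge0// divr_ge0// subr_ge0 ltW.
  by rewrite exprS; nra.
have S1' : (1 - X) * S = 1.
  by rewrite mulrBl mul1r [V in V - _](subr0_eq S1) addrK.
have k1 : (k^-1)%:C * k%:C = 1 by rewrite -rmorphM mulVf ?gt_eqF.
exists ((k^-1)%:C *: S); rewrite -!ascaleAl -!ascaleAr !scalerA.
rewrite [k%:C * _]mulrC k1 !scale1r S1'; split=> //.
by rewrite mulrBr mulr1 XS -S1' mulrBl mul1r.
Qed.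

End PositiveOperators.

(** * Positivity of squares, through norms *)

Section NormPositive.
Context (R : realType) (A : cstarType R) (H : hilbertModType A).
Implicit Types (S T U V X g h p y : 'L(H)) (x : H) (c d k : R).

(** For self-adjoint [T] this is the norm criterion for [T >= 0]. In this form, sums of positive
    operators are positive by the triangle inequality. *)
Definition npos T := exists2 k, 0 <= k & opbound (k%:C *: (1 : 'L(H)) - T) k.

Lemma nposD S T : npos S -> npos T -> npos (S + T).
Proof.
move=> [k k0 Sk] [d d0 Td]; exists (k + d); first exact: addr_ge0.
by rewrite rmorphD scalerDl opprD addrACA; apply: opboundD.
Qed.

(** [(k + 1) - (1 + T) = k - T] has bound [k], and the ratio [k / (k + 1)] is below 1. *)
Lemma npos_spos T : adj T = T -> npos T -> spos (1 + T).
Proof.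
move=> Ta [k k0 Tk]; split; first by rewrite adjD adj1 Ta.
have k1 : 0 < k + 1 by lra.
exists (k + 1), (k / (k + 1)); split=> //.
  by rewrite divr_ge0//= ?(ltW k1)// ltr_pdivrMr// mul1r; lra.
rewrite divfK ?gt_eqF// rmorphD scalerDl rmorph1 scale1r.
by rewrite [1 + T]addrC opprD addrACA subrr addr0.
Qed.

Lemma opbound_isometry U : adj U * U = 1 -> opbound U 1.
Proof.
move=> U1 x; rewrite mul1r (@rnorm_isometric _ _ _ (U x) x)//.
by rewrite aadjP -[aadj U _]/((adj U * U) x) U1.
Qed.

Lemma adj_selfconj_i U V : adj U = U -> adj V = V ->
  adj (U + 'i *: V) = U - 'i *: V.
Proof. by move=> Ua Va; rewrite adjD adjZ conj_i Ua Va scaleNr. Qed.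

(* If [|g| < 1] then [u = g + i sqrt (1 - g^2)] is unitary, and [2 g^2 - 1] is
   the real part of the unitary [u^2]. *)
Lemma opbound_square g c : adj g = g -> 0 <= c < 1 -> opbound g c ->
  opbound (1 - (g * g + g * g)) 1.
Proof.
move=> ga /andP[c0 c1] gc.
have cc : 0 <= c * c < 1 by rewrite mulr_ge0//=; nra.
have gga : adj (g * g) = g * g by rewrite adjM ga.
have [Z [Za Zc Zg ZV]] := sqrt_subr1 gga cc (opboundM c0 gc gc).
set s := 1 - Z in Zg.
have sa : adj s = s by rewrite adjB adj1 Za.
have gs : g * s = s * g.
  by rewrite mulrBl mulrBr mul1r mulr1 ZV ?mulrA.
clearbody s.
pose u := g + 'i *: s; pose v := g - 'i *: s.
have ua : adj u = v by apply: adj_selfconj_i.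
have ii : 'i * 'i = -1 :> R[i] by rewrite -expr2 sqrCi.
have sqE : ('i *: s) * ('i *: s) = - (s * s).
  by rewrite -ascaleAl -ascaleAr scalerA ii scaleN1r.
have isg : ('i *: s) * g = g * ('i *: s) by rewrite -ascaleAl -ascaleAr gs.
have ggss : g * g + s * s = 1 by rewrite Zg addrCA subrr addr0.
have vu : v * u = 1.
  by rewrite mulrDr !mulrBl isg sqE opprK addrA subrK.
have uv : u * v = 1.
  by rewrite mulrDl !mulrBr isg sqE opprK addrA subrK.
have u1 : opbound u 1 by apply: opbound_isometry; rewrite ua.
have v1 : opbound v 1 by apply: opbound_isometry; rewrite -ua adjK ua.
(* Both [u] and its adjoint [v] are isometric, and [2 g^2 - 1] is the average of [u^2] and [v^2]. *)
have -> : 1 - (g * g + g * g) = - ((2%:R^-1)%:C *: (u * u + v * v)).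
  have -> : u * u + v * v = ((g * g + g * g) - 1) + ((g * g + g * g) - 1).
    have -> : g * g + g * g - 1 = g * g - s * s.
      by rewrite -ggss opprD addrACA subrr add0r.
    rewrite /u /v mulrBl !mulrBr mulrDl !mulrDr isg sqE opprK opprD.
    move: (g * ('i *: s)) (g * g) (s * s) => a b d.
    rewrite [X in X + _ = _](AC (2*2) ((1*4)*(2*3))) /=.
    rewrite [X in _ + X = _](AC (2*2) ((1*4)*(2*3))) /=.
    by rewrite [LHS]addrACA -opprD subrr addr0.
  rewrite scalerDr -scalerDl -rmorphD.
  have -> : 2%:R^-1 + 2%:R^-1 = 1 :> R by field.
  by rewrite scale1r opprB.
apply/opboundN/(opbound_le _ (opboundZ _ (opboundD (opboundM ler01 u1 u1)
  (opboundM ler01 v1 v1)))).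
by rewrite ger0_norm ?invr_ge0//; lra.
Qed.

Lemma npos_square h : adj h = h -> npos (h * h).
Proof.
move=> ha; have [b b0 hb] := adjointable_bounded h.
have b1 : 0 < b + 1 by lra.
(* Dividing by [b + 1] instead of [b] gives a bound strictly below 1 and allows [b = 0]. *)
pose g := ((b + 1)^-1)%:C *: h.
have ga : adj g = g by rewrite adjZ conj_real ha.
have gb : opbound g (b / (b + 1)).
  apply: opbound_le (opboundZ _ hb).
  by rewrite gtr0_norm ?invr_gt0// mulrC.
have b01 : 0 <= b / (b + 1) < 1.
  by rewrite divr_ge0//= ?(ltW b1)// ltr_pdivrMr// mul1r; lra.
have := opbound_square ga b01 gb.
(* With this factor [k (1 - 2 g^2) = k - h^2]. *)
set k := (b + 1) ^+ 2 / 2%:R => /(opboundZ k).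
have k0 : 0 <= k by rewrite divr_ge0// exprn_ge0 // ltW.
rewrite ger0_norm// mulr1 => kP; exists k => //.
move: kP; congr opbound; rewrite scalerBr; congr (_ - _).
rewrite -mulr2n -scaler_nat -ascaleAl -ascaleAr !scalerA.
rewrite -(rmorph_nat (real_complex R)) -!rmorphM.
rewrite [X in X%:C *: _](_ : _ = 1) ?scale1r//.
by rewrite /k; field; rewrite gt_eqF.
Qed.

(** On the range of [p] the operator [k + 2 p] is multiplication by [k + 2], while its bound is
    [k]. *)
Lemma npos_opp_projection p : p * p = p -> npos (- (p + p)) -> p = 0.
Proof.
move=> pp [k k0 kp]; apply: op_ext => x; apply: rnorm_le0.
have := kp (p x).
have -> : (k%:C *: (1 : 'L(H)) - - (p + p)) (p x) = (k + 2%:R)%:C *: p x.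
  have ppx : p (p x) = p x by rewrite -[in RHS]pp.
  rewrite opprK !opE !ppx rmorphD scalerDl rmorph_nat.
  by rewrite scaler_nat mulr2n.
rewrite rnormZr ger0_norm ?addr_ge0//.
by have := rnorm_ge0 (p x); nra.
Qed.

(* [y^* y = - p <= 0] makes [q = - y y^*] a projection, and writing
   [y = (a - i b) / 2] one gets [- (2 p) = 2 q + a^2 + b^2]. *)
Lemma adj_mul_opp_projection y p : adj p = p -> p * p = p -> y * p = y ->
  adj y * y = - p -> p = 0.
Proof.
move=> pa pp yp yyp; apply: npos_opp_projection => //.
pose q := - (y * adj y); pose a := y + adj y; pose b := 'i *: (y - adj y).
have qa : adj q = q by rewrite adjN adjM adjK.
have qq : q * q = q.
  by rewrite mulNr mulrN opprK mulrA -[y * _ * _]mulrA yyp mulrN yp mulNr.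
have aa : adj a = a by rewrite adjD adjK addrC.
have ba : adj b = b.
  by rewrite adjZ conj_i adjB adjK scaleNr -scalerN opprB.
(* Here [a^2 + b^2 = 2 (y y^* + y^* y)]; adding [2 q] leaves [2 y^* y = - 2 p]. *)
have := nposD (nposD (npos_square qa) (npos_square qa))
              (nposD (npos_square aa) (npos_square ba)).
congr npos; rewrite qq.
have ii : 'i * 'i = -1 :> R[i] by rewrite -expr2 sqrCi.
rewrite -ascaleAl -ascaleAr scalerA ii scaleN1r.
rewrite /q /a mulrBl !mulrBr mulrDl !mulrDr yyp.
move: (y * y) (adj y * adj y) (y * adj y) => m n t.
rewrite ![in X in _ + X]opprB.
rewrite (AC (2*((2*2)*(2*2))) (((1*4)*(2*9))*((3*10)*(6*8))*(5*7))) /=.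
by rewrite !addNr !subrr !add0r -opprD.
Qed.

End NormPositive.

(** * The operator [Q + adj Q - 1] and uniqueness of positive square roots *)

Section IdempotentAlgebra.
Context (R : realType) (A : cstarType R) (H : hilbertModType A).
Implicit Types (S T U V C P Q p y : 'L(H)).

Lemma inv_adj T W : adj T = T -> W * T = 1 -> T * W = 1 -> adj W = W.
Proof.
move=> Ta WT TW; rewrite -[LHS]mulr1 -TW mulrA -{1}Ta -adjM TW.
by rewrite adj1 mul1r.
Qed.

Lemma inv_comm T W V : W * T = 1 -> T * W = 1 -> T * V = V * T -> W * V = V * W.
Proof.
move=> WT TW TV.
by rewrite -[LHS]mulr1 -TW mulrA -[W * V * T]mulrA -TV mulrA WT mul1r.
Qed.

(** For a projection [Q] this is the symmetry [2 Q - 1]. *)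
Definition gram Q := Q + adj Q - 1.

Lemma gram_adj Q : gram (adj Q) = gram Q.
Proof. by rewrite /gram adjK [adj Q + Q]addrC. Qed.

Lemma gram_sqr Q : Q * Q = Q ->
  gram Q * gram Q = Q * adj Q + adj Q * Q - Q - adj Q + 1.
Proof.
move=> QQ; have aQQ : adj Q * adj Q = adj Q by rewrite -adjM QQ.
rewrite /gram mulrBl mul1r !mulrBr !mulr1 mulrDl !mulrDr QQ aQQ.
rewrite opprB !opprD.
rewrite [LHS](AC (((2*2)*2)*(1*2)) (((1*5)*(4*6))*(2*3*8*9*7))) /=.
by rewrite !subrr !add0r.
Qed.

(** As ['i *: (Q - adj Q)] is self-adjoint, this presents the square of [gram Q] as 1 plus a
    positive operator. *)
Lemma gram_sqr_eq Q : Q * Q = Q ->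
  gram Q * gram Q = 1 + ('i *: (Q - adj Q)) * ('i *: (Q - adj Q)).
Proof.
move=> QQ; have aQQ : adj Q * adj Q = adj Q by rewrite -adjM QQ.
rewrite gram_sqr// -ascaleAl -ascaleAr scalerA -expr2 sqrCi scaleN1r.
rewrite mulrBl !mulrBr QQ aQQ.
by rewrite !opprB [RHS](AC (1*(2*2)) (4*2*5*3*1)).
Qed.

(** [S] is a fourth root of [gram Q * gram Q], so that its square root [K = S * S] visibly has the
    form [adj S * S] demanded by [apositive]. [W] is the inverse of [S]. *)
Lemma sqrt_gram Q : Q * Q = Q -> exists S W, [/\ adj S = S,
  S * W = 1, W * S = 1, (S * S) * (S * S) = gram Q * gram Q &
  forall V, gram Q * gram Q * V = V * (gram Q * gram Q) -> S * V = V * S].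
Proof.
move=> QQ.
pose h := 'i *: (Q - adj Q).
have ha : adj h = h.
  by rewrite adjZ conj_i adjB adjK scaleNr -scalerN opprB.
have hha : adj (h * h) = h * h by rewrite adjM ha.
have := npos_spos hha (npos_square ha); rewrite -gram_sqr_eq//.
move=> /spos_sqrt[K [Kpos KK KV]].
have [S [Spos SS SV]] := spos_sqrt Kpos.
have [W [WS SW]] := spos_inv Spos.
exists S, W; split=> //; first by case: Spos.
  by rewrite SS KK.
by move=> V /KV /SV.
Qed.

(** Uniqueness of the positive square root of [K^2] in the corner cut out by [P], where [K = S * S]:
    if [T] is not [K P], it is [- K] on a nonzero projection [p], against [T = adj C * C]. *)
Lemma positive_sqrt_corner P S W T C : adj P = P -> P * P = P ->
  adj S = S -> S * W = 1 -> W * S = 1 -> S * P = P * S ->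
  adj C * C = T -> T * P = T -> S * T = T * S ->
  T * T = S * S * (S * S) * P -> T = S * S * P.
Proof.
move=> Pa PP Sa SW WS SP CT TP ST TT.
have Ta : adj T = T by rewrite -CT adjM adjK.
have PT : P * T = T by rewrite -{1}Ta -{1}Pa -adjM TP Ta.
have Wa := inv_adj Sa WS SW.
have WP := inv_comm WS SW SP.
have WT := inv_comm WS SW ST.
have [K KE] : exists K, K = S * S by eexists.
have [L LE] : exists L, L = W * W by exists (W * W).
have LK : L * K = 1 by rewrite KE LE mulrA -[W * W * S]mulrA WS mulr1 WS.
have KL : K * L = 1 by rewrite KE LE mulrA -[S * S * W]mulrA SW mulr1 SW.
have LT : L * T = T * L by rewrite LE -mulrA WT mulrA WT mulrA.
have LP : L * P = P * L by rewrite LE -mulrA WP mulrA WP mulrA.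
have KP : K * P = P * K by rewrite KE -mulrA SP mulrA SP mulrA.
have KT : K * T = T * K by rewrite KE -mulrA ST mulrA ST mulrA.
have La : adj L = L by rewrite LE adjM Wa.
rewrite -!KE in TT *.
(* [J^2 = P], and [p = (P - J) / 2] is the projection on which [T] is [- K]. *)
pose J := T * L.
have JK : J * K = T by rewrite /J -mulrA LK mulr1.
have JJ : J * J = P.
  rewrite /J [LHS]mulrA -[T * L * T]mulrA LT mulrA TT -mulrA.
  have -> : K * K * P = P * (K * K) by rewrite -mulrA KP mulrA KP mulrA.
  by rewrite -!mulrA [K * (L * L)]mulrA KL mul1r KL mulr1.
have JP : J * P = J by rewrite /J -mulrA LP mulrA TP.
have PJ : P * J = J by rewrite /J mulrA PT.
have Ja : adj J = J by rewrite /J adjM La Ta LT.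
have KJ : K * J = T by rewrite /J mulrA KT -mulrA KL mulr1.
have WJ : W * J = J * W by rewrite /J mulrA WT LE !mulrA.
clearbody J.
pose h : R[i] := (2%:R^-1)%:C.
have hh (U : 'L(H)) : h *: (U + U) = U.
  rewrite scalerDr -scalerDl -rmorphD.
  have -> : 2%:R^-1 + 2%:R^-1 = 1 :> R by field.
  by rewrite scale1r.
have [p pE] : exists p, p = h *: (P - J) by exists (h *: (P - J)).
have pa : adj p = p by rewrite pE adjZ conj_real adjB Pa Ja.
have pJ : p * J = - p by rewrite pE -ascaleAl mulrBl PJ JJ -scalerN opprB.
have pP : p * P = p by rewrite pE -ascaleAl mulrBl PP JP.
have pp : p * p = p by rewrite {2}pE -ascaleAr mulrBr pP pJ opprK hh.
have Jp : J * p = - p by rewrite pE -ascaleAr mulrBr JP JJ -scalerN opprB.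
have Wp : W * p = p * W by rewrite pE -ascaleAl -ascaleAr mulrBl mulrBr WP WJ.
have Kp : K * p = p * K.
  by rewrite pE -ascaleAl -ascaleAr mulrBl mulrBr KP KJ JK.
have p0 : p = 0.
  (* For [y = C p W] one gets [y^* y = W p T p W = - W K p W = - p]. *)
  apply: (@adj_mul_opp_projection _ _ _ (C * p * W)) => //.
    by rewrite -mulrA Wp mulrA -[C * p * p]mulrA pp.
  rewrite !adjM Wa pa !mulrA -[W * p * adj C * C]mulrA CT.
  rewrite -[W * p * T * p]mulrA -KJ -[K * J * p]mulrA Jp !mulrN mulNr.
  congr (- _); rewrite mulrA -[W * p * K]mulrA -Kp KE !mulrA WS mul1r.
  by rewrite -[S * p * p]mulrA pp -mulrA -Wp mulrA SW mul1r.
have /subr0_eq PJ0 : P - J = 0 by rewrite -(hh (P - J)) scalerDr -pE p0 addr0.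
by rewrite PJ0 KJ.
Qed.

End IdempotentAlgebra.

(** * Operators on a complemented submodule as a corner of ['L(H)] *)

Section Corner.
Context (R : realType) (A : cstarType R) (H : hilbertModType A).
Context (V : submodule H) (P : 'L(H)) (PV : proj_onto V P).
Implicit Types (S T : 'L(H)).
Local Notation E := (smtype V : formModType A).

(** A submodule carries only a form, without norm or positivity; definiteness is borrowed from
    [H]. *)
Lemma sm_form_inj (x y : E) : (forall z : E, <|z, x|> = <|z, y|> :> A) -> x = y.
Proof.
move=> xy; apply/val_inj/subr0_eq/rnorm_eq0/eqP.
rewrite -sqrf_eq0 -rnorm_form.
have := xy (x - y); rewrite -[LHS]/(<|val x - val y, val x|>).
rewrite -[RHS]/(<|val x - val y, val y|>) => {}xy.
by rewrite formDr formNr [X in X - _]xy subrr rnorm0.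
Qed.

Lemma corner_op_ext (S T : 'L(E)) : S =1 T -> S = T.
Proof.
move=> ST; apply: adjointable_eq => // x; apply: sm_form_inj => z.
by rewrite -!aadjP ST.
Qed.

Lemma corner_projK x : P (P x) = P x.
Proof. by have [[pp _] _] := PV; rewrite -[in RHS]pp. Qed.

Lemma corner_proj_adj : adj P = P.
Proof. by have [[]] := PV. Qed.

Lemma corner_proj_sym x y : <|P x, y|> = <|x, P y|> :> A.
Proof. by rewrite aadjP -[aadj P]/(afun (adj P)) corner_proj_adj. Qed.

Lemma corner_mem x : smcar V (P x).
Proof. by have [_ <-] := PV; exists x. Qed.

Lemma corner_fix (y : E) : P (smval y) = smval y.
Proof.
have [_ rP] := PV; have := smvalV y; rewrite -rP => -[x _ <-].
exact: corner_projK.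
Qed.

Lemma corner_subproof T (x y : E) :
  <|(smin (corner_mem (T (smval x))) : E), y|> =
  <|x, (smin (corner_mem (aadj T (smval y))) : E)|> :> A.
Proof.
rewrite -[LHS]/(<|P (T (smval x)), smval y|>).
rewrite -[RHS]/(<|smval x, P (aadj T (smval y))|>).
rewrite corner_proj_sym corner_fix aadjP.
by rewrite -corner_proj_sym corner_fix.
Qed.

Definition corner T : 'L(E) := Adjointable (corner_subproof T).

Lemma corner_eqP (T : 'L(E)) S : (forall y, smval (T y) = S (smval y)) ->
  T = corner S.
Proof.
move=> TS; apply: corner_op_ext => y; apply: val_inj.
by rewrite /= -TS corner_fix.
Qed.

Lemma corner_comp S T : S * P = P * S -> corner S \oA corner T = corner (S * T).
Proof.
move=> SP; apply: corner_op_ext => y; apply: val_inj => /=.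
rewrite -[P (T _)]/((P * T) (smval y)) -[S (_ _)]/((S * (P * T)) _).
by rewrite mulrA SP -mulrA -[LHS]/(P (P _)) corner_projK.
Qed.

Lemma corner_adj T : adj (corner T) = corner (adj T).
Proof. exact: corner_op_ext. Qed.

Lemma corner1 : corner 1 = aid E.
Proof. by apply: corner_op_ext => y; apply: val_inj; rewrite /= corner_fix. Qed.

Lemma cornerD S T : corner (S + T) = corner S + corner T.
Proof. by apply: corner_op_ext => y; apply: val_inj; rewrite /= afunD. Qed.

Lemma lift_subproof (S : 'L(E)) (x y : H) :
  <|smval (S (smin (corner_mem x))), y|> =
  <|x, smval (aadj S (smin (corner_mem y)))|> :> A.
Proof.
rewrite -(corner_fix (S _)) corner_proj_sym.
rewrite -(corner_fix (aadj S _)) -[RHS]corner_proj_sym.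
exact: (aadjP S (smin (corner_mem x)) (smin (corner_mem y))).
Qed.

(** Extension by zero on the kernel of [P]. It moves identities between operators on the submodule
    into the ring ['L(H)]. *)
Definition lift (S : 'L(E)) : 'L(H) := Adjointable (lift_subproof S).

Lemma lift_comp (S T : 'L(E)) : lift (S \oA T) = lift S * lift T.
Proof.
apply: op_ext => x /=; congr (smval (S _)).
by apply: val_inj; rewrite /= corner_fix.
Qed.

Lemma lift_adj (S : 'L(E)) : lift (adj S) = adj (lift S).
Proof. exact: op_ext. Qed.

Lemma lift_projr (S : 'L(E)) : lift S * P = lift S.
Proof.
apply: op_ext => x /=; congr (smval (S _)).
by apply: val_inj; rewrite /= corner_projK.
Qed.

Lemma lift_corner T : lift (corner T) = P * T * P.
Proof. exact: op_ext. Qed.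

Lemma lift_inj : injective lift.
Proof.
move=> S T /(congr1 (fun U => afun U)) ST; apply: corner_op_ext => y.
apply: val_inj; have := congr1 (fun f => f (smval y)) ST => /=.
suff -> : smin (corner_mem (smval y)) = y by [].
by apply: val_inj; rewrite /= corner_fix.
Qed.

End Corner.

Lemma ainv_eq (R : realType) (A : cstarType R) (E : formModType A)
    (S T : 'L(E)) :
  S \oA T = aid E -> T \oA S = aid E -> ainv T = S.
Proof.
move=> ST TS; apply: xget_unique => // U [UT TU].
have -> : U = U \oA (T \oA S) by rewrite TS; apply: adjointable_eq.
have -> : U \oA (T \oA S) = (U \oA T) \oA S by apply: adjointable_eq.
by rewrite UT; apply: adjointable_eq.
Qed.

(** * The block matrix computed in ['L(H)] *)

Section MatchedFormula.
Context (R : realType) (A : cstarType R) (H : hilbertModType A).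
Implicit Types (Q P S W T : 'L(H)).

Lemma corner_congr (V : submodule H) P (PV : proj_onto V P) S T :
  P * S * P = P * T * P -> corner PV S = corner PV T.
Proof. by move=> ST; apply: (@lift_inj _ _ _ _ _ PV); rewrite !lift_corner. Qed.

Lemma ran_proj_mull Q P : proj_onto (ran Q) P -> P * Q = Q.
Proof.
move=> PQ; apply: op_ext => x.
by apply: (corner_fix PQ (smin (_ : smcar (ran Q) (Q x)))); exists x.
Qed.

Lemma ran_proj_mulr Q P : Q * Q = Q -> proj_onto (ran Q) P -> Q * P = P.
Proof.
move=> QQ PQ; apply: op_ext => x.
have [y _] := corner_mem PQ x; rewrite -[P x]/(P x) => Py.
by rewrite opE -Py -[Q (Q y)]/((Q * Q) y) QQ.
Qed.

(** With [G = gram Q], invertible since its square is, the projection is [Q G^-1]. The identities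
    [G Q = adj Q * Q = adj Q * G] give [G^-1 adj Q = Q G^-1], hence self-adjointness and
    idempotence. *)
Lemma ran_proj_exists Q S W : Q * Q = Q -> S * W = 1 -> W * S = 1 ->
  S * S * (S * S) = gram Q * gram Q -> exists P, proj_onto (ran Q) P.
Proof.
move=> QQ SW WS GG; have aQQ : adj Q * adj Q = adj Q by rewrite -adjM QQ.
set G := gram Q in GG *.
have Ga : adj G = G by rewrite adjB adj1 adjD adjK [adj Q + Q]addrC.
pose L := W * W * (W * W).
have LGG : L * (G * G) = 1.
  rewrite -GG /L -!mulrA; do 3 rewrite [W * (S * _)]mulrA WS mul1r.
  exact: WS.
have GGL : G * G * L = 1.
  rewrite -GG /L -!mulrA; do 3 rewrite [S * (W * _)]mulrA SW mul1r.
  exact: SW.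
pose N := L * G.
have NG : N * G = 1 by rewrite /N -mulrA.
have GN : G * N = 1.
  have LG : L * G = G * L by apply: (inv_comm LGG GGL); rewrite mulrA.
  by rewrite /N LG mulrA.
have Na := inv_adj Ga NG GN.
have GQ : G * Q = adj Q * Q by rewrite mulrBl mulrDl QQ mul1r addrC addKr.
have aQG : adj Q * G = adj Q * Q by rewrite mulrBr mulrDr aQQ mulr1 addrK.
have NaQ : N * adj Q = Q * N.
  by rewrite -[LHS]mulr1 -GN mulrA -[N * adj Q * G]mulrA aQG -GQ mulrA NG mul1r.
exists (Q * N); split; last first.
  apply/seteqP; split=> _ [x _ <-]; first by exists (N x).
  by exists (G x) => //; rewrite -[RHS]/(Q ((1 : 'L(H)) x)) -NG.
split; last by rewrite adjM Na NaQ.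
rewrite /idempotent_op -[LHS]/(Q * N * (Q * N)) -{1}NaQ mulrA -[_ * Q]mulrA -GQ.
by rewrite mulrA NG mul1r.
Qed.

Section Block.
Context (Q : 'L(H)) (idQ : idempotent_op Q).
Context (P : 'L(H)) (PQ : proj_onto (ran Q) P).
Context (S W : 'L(H)) (Sa : adj S = S) (SW : S * W = 1) (WS : W * S = 1).
Context (GG : S * S * (S * S) = gram Q * gram Q).
Context (GV : forall V,
  gram Q * gram Q * V = V * (gram Q * gram Q) -> S * V = V * S).

Let QQ : Q * Q = Q. Proof. exact: idQ. Qed.
Let aQQ : adj Q * adj Q = adj Q. Proof. by rewrite -adjM QQ. Qed.
Let Pa : adj P = P := corner_proj_adj PQ.
Let PP : P * P = P. Proof. by apply: op_ext => x; exact: (corner_projK PQ). Qed.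
Let PmQ : P * Q = Q := ran_proj_mull PQ.
Let QmP : Q * P = P := ran_proj_mulr QQ PQ.
Let aQP : adj Q * P = adj Q. Proof. by rewrite -{1}Pa -adjM PmQ. Qed.
Let PaQ : P * adj Q = P. Proof. by rewrite -{1}Pa -adjM QmP Pa. Qed.

(** With [PGG] this shows that [P] commutes with the square of [gram Q], hence with [S]. *)
Let GGP : gram Q * gram Q * P = Q * adj Q.
Proof.
rewrite gram_sqr// !(mulrDl, mulNr) mul1r -!mulrA QmP aQP.
by rewrite addrAC subrK addrK.
Qed.

Let PGG : P * (gram Q * gram Q) = Q * adj Q.
Proof.
rewrite gram_sqr// !(mulrDr, mulrN) mulr1 !mulrA PaQ !PmQ.
by rewrite subrK addrK.
Qed.

Let GGQ : gram Q * gram Q * Q = Q * (gram Q * gram Q).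
Proof.
rewrite gram_sqr// !(mulrDl, mulNr, mulrDr, mulrN) mulr1 mul1r.
rewrite !mulrA -[adj Q * Q * Q]mulrA QQ.
by rewrite [LHS]addrAC subrK addrK [RHS]addrAC subrK [RHS]addrC addKr.
Qed.

Let SP : S * P = P * S.
Proof. by apply: GV; rewrite GGP PGG. Qed.
Let SQ : S * Q = Q * S.
Proof. exact: GV. Qed.
Let SaQ : S * adj Q = adj Q * S.
Proof. by rewrite -[in LHS]Sa -adjM -SQ adjM Sa. Qed.

(** From [Q P = P] and [P Q = Q], compressing [(Q - P) (adj Q - P) + 1] by [P] gives [Q adj Q],
    which is [P] times the square of [gram Q]. *)
Lemma mpB_gram :
  mpA idQ PQ \oA adj (mpA idQ PQ) + aid _ = corner PQ (S * S * (S * S)).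
Proof.
transitivity (corner PQ ((Q - P) * (adj Q - P) + 1)).
  exact: corner_eqP.
apply: corner_congr; rewrite GG PGG.
rewrite mulrBl !mulrBr PaQ QmP PP subrr subr0.
by rewrite mulrDr mulr1 mulrBr mulrA PmQ PP subrK -mulrA aQP.
Qed.

(** The corner of [S] witnesses positivity of the candidate. Any other positive root is lifted to
    [H] and identified by [positive_sqrt_corner]. *)
Lemma mpB_corner : mpB idQ PQ = corner PQ (S * S).
Proof.
have SSP : S * S * P = P * (S * S) by rewrite -mulrA SP mulrA SP mulrA.
apply: xget_unique; rewrite mpB_gram.
  split; last by rewrite corner_comp.
  by exists (corner PQ S); rewrite corner_adj Sa corner_comp.
move=> U [[C UC] UU]; apply: (@lift_inj _ _ _ _ _ PQ).
rewrite lift_corner -SSP -mulrA PP.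
have LU : lift PQ U * lift PQ U = S * S * (S * S) * P.
  by rewrite -lift_comp UU lift_corner GG PGG -mulrA aQP GGP.
apply: (@positive_sqrt_corner _ _ _ _ S W _ (lift PQ C)) => //.
- by rewrite -lift_adj -lift_comp UC.
- exact: lift_projr.
(* [T] commutes with [T^2 = G^2 P], where [G = gram Q], and [T = P T = T P] absorbs [P]; so it
   commutes with [G^2], hence with [S]. *)
apply: GV; set T := lift PQ U in LU *.
have TP : T * P = T by apply: lift_projr.
have GT : gram Q * gram Q * P = P * (gram Q * gram Q) by rewrite GGP PGG.
have PT : P * T = T.
  by apply: op_ext => x; exact: (corner_fix PQ).
have TT : T * T = gram Q * gram Q * P by rewrite LU GG.
by rewrite -{1}PT mulrA -TT -[in RHS]TP -[RHS]mulrA -GT -TT mulrA.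
Qed.

Let W2 : W * W * (S * S) = 1.
Proof. by rewrite mulrA -[W * W * S]mulrA WS mulr1 WS. Qed.
Let S2 : S * S * (W * W) = 1.
Proof. by rewrite mulrA -[S * S * W]mulrA SW mulr1 SW. Qed.
Let W2comm V : S * V = V * S -> W * W * V = V * (W * W).
Proof.
by move=> /(inv_comm WS SW) WV; rewrite -mulrA WV mulrA WV mulrA.
Qed.
Let S2comm V : S * V = V * S -> S * S * V = V * (S * S).
Proof. by move=> SV; rewrite -mulrA SV mulrA SV mulrA. Qed.

Lemma matched_blockE : matched_block idQ PQ =
  2^-1 *: (1 + W * W * gram Q).
Proof.
(* [N] is [(1 + K)^-1] for [K = S * S], and [W * W] is [K^-1]. *)
have [N [NS SN]] : exists N, N * (1 + S * S) = 1 /\ (1 + S * S) * N = 1.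
  by apply/spos_inv/npos_spos/npos_square; rewrite ?adjM ?Sa.
have SSP := S2comm SP; have WWP := W2comm SP.
have SS1P : (S * S + 1) * P = P * (S * S + 1).
  by rewrite mulrDl mulrDr mul1r mulr1 SSP.
have NP : N * P = P * N.
  by apply: (inv_comm NS SN); rewrite addrC SS1P.
have iB : ainv (mpB idQ PQ) = corner PQ (W * W).
  by rewrite mpB_corner; apply: ainv_eq; rewrite corner_comp// ?W2 ?S2 corner1.
have B1 : mpB idQ PQ + aid _ = corner PQ (S * S + 1).
  by rewrite mpB_corner cornerD corner1.
have iBB : ainv (mpB idQ PQ \oA (mpB idQ PQ + aid _)) = corner PQ (N * (W * W)).
  rewrite B1 mpB_corner corner_comp//; apply: ainv_eq.
    rewrite corner_comp; last by rewrite -mulrA WWP mulrA NP -mulrA.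
    rewrite -(corner1 PQ); congr corner.
    by rewrite -mulrA [W * W * _]mulrA W2 mul1r addrC.
  rewrite corner_comp; last by rewrite -mulrA SS1P mulrA SSP -mulrA.
  rewrite -(corner1 PQ); congr corner.
  by rewrite -mulrA [(_ + 1) * _]mulrA addrC SN mul1r S2.
(* The four entries as operators on [H]: [mpU] contributes [P] and [1 - P] on the right, and its
   adjoint adds the two components. *)
have -> : matched_block idQ PQ =
    2^-1 *: (P * (S * S + 1) * (P * (W * W) * P)
              + P * (W * W) * ((Q - P) * (1 - P)))
  + 2^-1 *: ((adj Q - P) * (P * (W * W) * P)
              + (adj Q - P) * (P * (N * (W * W)) * ((Q - P) * (1 - P)))).
  by rewrite /matched_block iB iBB B1; apply: op_ext.
rewrite -scalerDr; congr (_ *: _).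
have WWaQ := W2comm SaQ.
have NQ : N * adj Q = adj Q * N.
  by apply: (inv_comm NS SN); rewrite mulrDl mulrDr mul1r mulr1 S2comm.
have WWS : W * W * (S * S + 1) = (S * S + 1) * (W * W).
  by rewrite mulrDr mulrDl mulr1 mul1r W2 S2.
have SSSS : S * S * (S * S) - 1 = (S * S + 1) * (S * S - 1).
  by rewrite mulrBr mulr1 mulrDl mul1r opprD addrA addrK.
have PWP : P * (W * W) * P = W * W * P by rewrite -WWP -mulrA PP.
rewrite PWP.
have -> : (Q - P) * (1 - P) = Q - P.
  by rewrite mulrBr mulr1 mulrBl QmP PP subrr subr0.
have -> : P * (S * S + 1) * (W * W * P) = P + W * W * P.
  by rewrite -SS1P -mulrA [P * _]mulrA PWP mulrDl mul1r mulrA S2 mul1r.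
have -> : P * (W * W) * (Q - P) = W * W * Q - W * W * P.
  by rewrite -WWP -mulrA mulrBr PmQ PP mulrBr.
have -> : (adj Q - P) * (W * W * P) = W * W * adj Q - W * W * P.
  rewrite mulrBl [adj Q * _]mulrA -WWaQ -[_ * adj Q * P]mulrA aQP.
  by rewrite [P * _]mulrA PWP.
(* The lower right entry is [(1 - K^-1) (1 - P)], because [(adj Q - P) (Q - P) = (K^2 - 1) (1 - P)]
   and [K^2 - 1 = (K + 1) (K - 1)]. *)
have -> : (adj Q - P) * (P * (N * (W * W)) * (Q - P)) =
    (1 - P) - (W * W - W * W * P).
  have -> : P * (N * (W * W)) * (Q - P) = N * (W * W) * (Q - P).
    rewrite mulrA -NP -[N * P * _]mulrA -WWP mulrA -[_ * P * _]mulrA.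
    by rewrite mulrBr PmQ PP.
  rewrite mulrA.
  have -> : (adj Q - P) * (N * (W * W)) = N * (W * W) * (adj Q - P).
    rewrite mulrBl mulrBr !mulrA -NQ -NP -!mulrA; congr (N * _ - N * _).
      by rewrite -WWaQ -mulrA.
    by rewrite -WWP -mulrA.
  rewrite -mulrA.
  have -> : (adj Q - P) * (Q - P) = (S * S * (S * S) - 1) * (1 - P).
    rewrite [LHS]mulrBl !mulrBr PmQ PP aQP mulr1 [in RHS]mulrBl GG GGP mul1r.
    rewrite gram_sqr//.
    rewrite addrK !opprB.
    by rewrite [RHS](AC (4*2) ((1*6)*((2*4)*(5*3)))) /= subrr add0r.
  rewrite SSSS -[(S * S + 1) * _ * _]mulrA [N * _ * _]mulrA.
  rewrite -[N * (W * W) * (S * S + 1)]mulrA WWS [N * (_ * _)]mulrA.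
  rewrite [S * S + 1]addrC NS mul1r [_ * (_ * (1 - P))]mulrA.
  rewrite [W * W * (S * S - 1)]mulrBr mulr1 W2 mulrBl mul1r.
  by rewrite mulrBr mulr1.
(* All terms containing [P] cancel, leaving [1 + K^-1 (Q + adj Q - 1)]. *)
rewrite opprB.
rewrite [LHS](AC ((2*2)*(2*(2*2))) (((1*8)*((2*4)*(9*6)))*(7*((3*5)*10)))) /=.
by rewrite !subrr !add0r mulrBr mulrDr mulr1.
Qed.

End Block.

(** Every admissible [P] yields the same value and one exists, so [xget] returns that value and not
    its default 0. *)
Lemma matched_formula Q S W : Q * Q = Q -> ~ projection Q ->
  adj S = S -> S * W = 1 -> W * S = 1 ->
  S * S * (S * S) = gram Q * gram Q ->
  (forall V, gram Q * gram Q * V = V * (gram Q * gram Q) -> S * V = V * S) ->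
  matched Q = 2^-1 *: (1 + W * W * gram Q).
Proof.
move=> QQ nQ Sa SW WS GG GV; rewrite /matched asboolF//.
apply: xget_unique => [|_ [idQ [P [PQ ->]]]]; last exact: matched_blockE GV.
have [P PQ] := ran_proj_exists QQ SW WS GG.
by exists QQ, P, PQ; rewrite (matched_blockE _ _ Sa SW WS GG GV).
Qed.

End MatchedFormula.

Theorem theorem3p7 (R : realType) (A : cstarType R) (H : hilbertModType A)
  (Q : 'L(H)) (hQ : idempotent_op Q) : matched (adj Q) = matched Q.
Proof.
have [[_ ->]//|nQ] := pselect (projection Q).
have naQ : ~ projection (adj Q).
  by move=> [_ aQ]; apply: nQ; split; rewrite // -aQ adjK.
(* The same [S] and [W] serve for [adj Q], since they depend on [Q] only through [gram Q]. *)
have [S [W [Sa SW WS GG GV]]] := sqrt_gram hQ.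
have aQaQ : adj Q * adj Q = adj Q by rewrite -adjM [Q * Q]hQ.
by rewrite (matched_formula hQ nQ Sa SW WS GG GV)
  (matched_formula aQaQ naQ Sa SW WS) gram_adj.
Qed.
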